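(* Let $I$ be a set and let $\langle A;\cdot,0,(\Diamond_i)_{i\in I},(d_{i,k})_{i,k\in I}\rangle$ be an $I$-dimensional cylindric quasi-implication algebra. For $x,y\in A$ put $1:=x\cdot x$, $x^\perp:=x\cdot 0$, $x\vee y:=((x\cdot y)\cdot(y\cdot x))\cdot x$, $x\wedge y:=((x\cdot y)\cdot(x\cdot 0))\cdot 0$, $\exists_i x:=\Diamond_i x$ and $\delta_{i,k}:=d_{i,k}$. Then $\langle A;\wedge,\vee,{}^\perp,0,1,(\exists_i)_{i\in I},(\delta_{i,k})_{i,k\in I}\rangle$ is an $I$-dimensional quantum cylindric algebra.
   Context: A quasi-implication algebra is a set $A$ with a binary operation $\cdot$ satisfying (1) $(x\cdot y)\cdot x=x$; (2) $(x\cdot y)\cdot(x\cdot z)=(y\cdot x)\cdot(y\cdot z)$; (3) $((x\cdot y)\cdot(y\cdot x))\cdot x=((y\cdot x)\cdot(x\cdot y))\cdot y$. In any quasi-implication algebra $x\cdot x=y\cdot y$ for all $x,y$, so the constant $1:=x\cdot x$ is well defined. A bounded quasi-implication algebra is a quasi-implication algebra with a constant $0$ such that $0\cdot x=1$ for all $x$. A monadic quasi-implication algebra $\langle A;\cdot,0,\Diamond\rangle$ is a bounded quasi-implication algebra $\langle A;\cdot,0\rangle$ with a unary operation $\Diamond$ satisfying: (a) $\Diamond\Diamond x\cdot\Diamond x=1$ and $x\cdot\Diamond x=1$; (b) $\Diamond(\Diamond x\cdot 0)=\Diamond x\cdot 0$ and $\Diamond 0=0$; (c) $\Diamond(((x\cdot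 0)\cdot(y\cdot 0))\cdot x)=((\Diamond x\cdot 0)\cdot(\Diamond y\cdot 0))\cdot\Diamond x$. ($\Diamond$ binds more tightly than $\cdot$.) An $I$-dimensional cylindric quasi-implication algebra is a structure $\langle A;\cdot,0,(\Diamond_i)_{i\in I},(d_{i,k})_{i,k\in I}\rangle$, with $d_{i,k}\in A$, such that: (1) $\langle A;\cdot,0,\Diamond_i\rangle$ is a monadic quasi-implication algebra for all $i\in I$; (2) $\Diamond_i\Diamond_k x=\Diamond_k\Diamond_i x$ for all $i,k\in I$ and $x\in A$; (3) $d_{i,k}=d_{k,i}$ and $d_{i,i}=1$ for all $i,k\in I$; (4) if $i\ne k$ and $l\neq k$ then $\Diamond_k(((d_{i,k}\cdot d_{k,l})\cdot(d_{i,k}\cdot 0))\cdot 0)=d_{i,l}$. An ortholattice is an algebra $\langle A;\wedge,\vee,{}^{\perp},0,1\rangle$ such that $\langle A;\wedge,\vee,0,1\rangle$ is a bounded lattice and $x\wedge x^\perp=0$, $x\vee x^\perp=1$, $x\le y\Rightarrow y^\perp\le x^\perp$, $x=x^{\perp\perp}$. It is an orthomodular lattice if $x\le y$ implies $y=x\vee(x^\perp\wedge y)$. A quantifier on an ortholattice $A$ is a map $\exists\colon A\to A$ with $\exists 0=0$, $x\le\exists x$, $\exists(x\vee y)=\exists x\vee\exists y$, $\exists\exists x=\exists x$, $\exists(\exists x)^\perp=(\exists x)^\perp$. An $I$-dimensional quantum cylindric algebra is a structure $\langle A;\wedge,\vee,{}^{\perp},0,1,(\exists_i)_{i\in I},(\delta_{i,k})_{i,k\in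 I}\rangle$ where $\langle A;\wedge,\vee,{}^{\perp},0,1\rangle$ is an orthomodular lattice, each $\exists_i$ is a quantifier, $\exists_i\exists_k a=\exists_k\exists_i a$ for all $i,k\in I$ and $a\in A$, and $\delta_{i,k}\in A$ are constants with $\delta_{i,k}=\delta_{k,i}$, $\delta_{i,i}=1$, and $\exists_k(\delta_{i,k}\wedge\delta_{k,l})=\delta_{i,l}$ whenever $i\neq k$ and $l\ne k$. *)

(* Defs.v *)
(* The carrier is an arbitrary type with Leibniz equality, hence the lattice laws
   are stated on plain operations: the order structures of MathComp would require
   a choiceType carrier with a boolean order.  No library is needed. *)
Set Implicit Arguments.
Unset Strict Implicit.

Section QuasiImplication.

Variables (A : Type) (imp : A -> A -> A).

Local Infix "**" := imp (at level 40, left associativity).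

Record is_quasi_implication_algebra : Prop := {
  qi_contract : forall x y, (x ** y) ** x = x;
  qi_exchange : forall x y z, (x ** y) ** (x ** z) = (y ** x) ** (y ** z);
  qi_join_sym : forall x y,
    ((x ** y) ** (y ** x)) ** x = ((y ** x) ** (x ** y)) ** y
}.

Lemma qi_self_const :
  is_quasi_implication_algebra -> forall x y, x ** x = y ** y.
Proof.
intros [contr exch jsym].
assert (absorb : forall x y, x ** (x ** y) = x ** y).
{ intros x y. pose proof (contr (x ** y) x) as H.
  rewrite (contr x y) in H. exact H. }
assert (shift : forall x y z, (x ** y) ** (x ** z) = x ** ((x ** y) ** z)).
{ intros x y z. pose proof (exch x (x ** y) z) as H.
  rewrite absorb, (contr x y) in H. exact H. }
assert (inv : forall x y, (y ** x) ** (y ** x) = x ** x).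
{ intros x y. rewrite <- (exch x y x), shift, contr. reflexivity. }
intros x y.
rewrite <- (inv x ((x ** y) ** (y ** x))), jsym. apply inv.
Qed.

Variable zero : A.

(* The constant 1 is the common value of all x ** x (qi_one_self below); the
   representative at zero is taken because the carrier has no other named point. *)
Definition qi_one : A := zero ** zero.

Lemma qi_one_self :
  is_quasi_implication_algebra -> forall x, x ** x = qi_one.
Proof. intros H x. exact (qi_self_const H x zero). Qed.

Definition qi_compl (x : A) : A := x ** zero.
Definition qi_join (x y : A) : A := ((x ** y) ** (y ** x)) ** x.
Definition qi_meet (x y : A) : A := ((x ** y) ** (x ** zero)) ** zero.

Record is_bounded_quasi_implication_algebra : Prop := {
  bqi_qi : is_quasi_implication_algebra;
  bqi_zero : forall x, zero ** x = qi_one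
}.

Record is_monadic_quasi_implication_algebra (dia : A -> A) : Prop := {
  mqi_bounded : is_bounded_quasi_implication_algebra;
  mqi_dia_idem : forall x, dia (dia x) ** dia x = qi_one;
  mqi_dia_ext : forall x, x ** dia x = qi_one;
  mqi_dia_compl : forall x, dia (dia x ** zero) = dia x ** zero;
  mqi_dia_zero : dia zero = zero;
  mqi_dia_join : forall x y,
    dia (((x ** zero) ** (y ** zero)) ** x) =
    ((dia x ** zero) ** (dia y ** zero)) ** dia x
}.

(* The bounded reduct is a separate field since I may be empty. *)
Record is_cylindric_quasi_implication_algebra (I : Type)
    (dia : I -> A -> A) (d : I -> I -> A) : Prop := {
  cqi_bounded : is_bounded_quasi_implication_algebra;
  cqi_monadic : forall i, is_monadic_quasi_implication_algebra (dia i);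
  cqi_dia_comm : forall i k x, dia i (dia k x) = dia k (dia i x);
  cqi_d_sym : forall i k, d i k = d k i;
  cqi_d_refl : forall i, d i i = qi_one;
  cqi_d_comp : forall i k l, i <> k -> l <> k ->
    dia k (((d i k ** d k l) ** (d i k ** zero)) ** zero) = d i l
}.

End QuasiImplication.

Section QuantumCylindric.

Variables (A : Type) (meet join : A -> A -> A) (compl : A -> A) (zero one : A).

Definition lat_le (x y : A) : Prop := meet x y = x.

Record is_bounded_lattice : Prop := {
  lat_meetC : forall x y, meet x y = meet y x;
  lat_joinC : forall x y, join x y = join y x;
  lat_meetA : forall x y z, meet x (meet y z) = meet (meet x y) z;
  lat_joinA : forall x y z, join x (join y z) = join (join x y) z;
  lat_meetK : forall x y, meet x (join x y) = x;
  lat_joinK : forall x y, join x (meet x y) = x;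
  lat_le0 : forall x, lat_le zero x;
  lat_le1 : forall x, lat_le x one
}.

Record is_ortholattice : Prop := {
  ol_lattice : is_bounded_lattice;
  ol_meet_compl : forall x, meet x (compl x) = zero;
  ol_join_compl : forall x, join x (compl x) = one;
  ol_compl_anti : forall x y, lat_le x y -> lat_le (compl y) (compl x);
  ol_compl_inv : forall x, x = compl (compl x)
}.

Record is_orthomodular_lattice : Prop := {
  oml_ortholattice : is_ortholattice;
  oml_orthomodular : forall x y,
    lat_le x y -> y = join x (meet (compl x) y)
}.

Record is_quantifier (ex : A -> A) : Prop := {
  ex_zero : ex zero = zero;
  ex_ext : forall x, lat_le x (ex x);
  ex_join : forall x y, ex (join x y) = join (ex x) (ex y);
  ex_idem : forall x, ex (ex x) = ex x;
  ex_compl : forall x, ex (compl (ex x)) = compl (ex x)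
}.

Record is_quantum_cylindric_algebra (I : Type)
    (ex : I -> A -> A) (delta : I -> I -> A) : Prop := {
  qca_orthomodular : is_orthomodular_lattice;
  qca_quantifier : forall i, is_quantifier (ex i);
  qca_ex_comm : forall i k a, ex i (ex k a) = ex k (ex i a);
  qca_delta_sym : forall i k, delta i k = delta k i;
  qca_delta_refl : forall i, delta i i = one;
  qca_delta_comp : forall i k l, i <> k -> l <> k ->
    ex k (meet (delta i k) (delta k l)) = delta i l
}.

End QuantumCylindric.

(* Main.v *)
From Stdlib Require Import Setoid.
Require Import Defs.

(** The product [x ** y] behaves as the Sasaki hook, the implication
    x^⊥ ∨ (x ∧ y) of an orthomodular lattice, and the lattice is recovered from
    the relation x ≤ y :⟺ [x ** y] = 1.

    The engine is the exchange axiom [qi_exchange].  If x ≤ y, its left factor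
    becomes 1 and disappears, so that [x ** z = (y ** x) ** (y ** z)]: a product
    with x on the left is rewritten as products with the larger y on the left
    ([imp_through_upper]).  This gives transitivity, monotonicity of
    [y ** _], antitonicity of the complement, and that [qi_meet] is the greatest
    lower bound.  Axiom [qi_join_sym] gives antisymmetry and, at 0, the
    involution law; so least upper bounds exist by De Morgan duality, and
    [qi_join] is shown to be one directly ([join_lub]).  All lattice laws
    then follow from the universal properties.

    For orthomodularity, let x ≤ y.  The complement of x acts trivially,
    [(x ** 0) ** y = y] ([compl_imp_upper]), so x^⊥ ∧ y is the complement of
    [y ** x], while [qi_join_sym] says that [y = (y ** x) ** x].  These two facts
    put y below every upper bound of x and x^⊥ ∧ y.

    Finally, the term in the additivity axiom for the operators is the De Morgan
    form [(x^⊥ ∧ y^⊥)^⊥] of the join, so this axiom is additivity of the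
    quantifiers; the remaining conditions on quantifiers and diagonals are
    direct translations. *)

(** * Order and lattice structure of a bounded quasi-implication algebra *)

Section BoundedQuasiImplication.

Set Implicit Arguments.

Variables (A : Type) (imp : A -> A -> A) (zero : A).
Hypothesis hA : is_bounded_quasi_implication_algebra imp zero.

Local Infix "**" := imp (at level 40, left associativity).
Local Notation one := (qi_one imp zero).
Local Notation "x <== y" := (x ** y = one) (at level 70).
Local Notation compl := (qi_compl imp zero).
Local Notation join := (qi_join imp).
Local Notation meet := (qi_meet imp zero).

Let contract := qi_contract (bqi_qi hA).
Let exchange := qi_exchange (bqi_qi hA).
Let join_sym := qi_join_sym (bqi_qi hA).

Lemma le_refl x : x <== x.
Proof. exact (qi_one_self zero (bqi_qi hA) x). Qed.

Lemma zero_le x : zero <== x.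
Proof. exact (bqi_zero hA x). Qed.

(** Contraction applied to the pair [x ** y], x, whose product is again x. *)
Lemma imp_absorb x y : x ** (x ** y) = x ** y.
Proof.
pose proof (contract (x ** y) x) as H.
now rewrite (contract x y) in H.
Qed.

Lemma imp_imp_common_l x y z : (x ** y) ** (x ** z) = x ** ((x ** y) ** z).
Proof. now rewrite <- (imp_absorb x y) at 1; rewrite exchange, contract. Qed.

Lemma one_imp x : one ** x = x.
Proof. rewrite <- (le_refl x). apply contract. Qed.

Lemma le_one x : x <== one.
Proof. rewrite <- (le_refl x). apply imp_absorb. Qed.

(** A product with x on the left is determined by products with any larger
    element on the left. *)
Lemma imp_through_upper x y z :
  x <== y -> x ** z = (y ** x) ** (y ** z).
Proof. intros H. now rewrite <- exchange, H, one_imp. Qed.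

Lemma le_trans x y z : x <== y -> y <== z -> x <== z.
Proof.
intros Hxy Hyz. rewrite (imp_through_upper _ Hxy), Hyz. apply le_one.
Qed.

Lemma le_antisym x y : x <== y -> y <== x -> x = y.
Proof.
intros Hxy Hyx. pose proof (join_sym x y) as H.
now rewrite Hxy, Hyx, le_refl, !one_imp in H.
Qed.

Lemma imp_mono_r x y z : x <== y -> z ** x <== z ** y.
Proof. intros H. rewrite exchange, H. apply le_one. Qed.

Lemma compl_le_imp x y : compl x <== x ** y.
Proof. apply imp_mono_r, zero_le. Qed.

(** Both sides of the symmetry axiom at x and 0 collapse. *)
Lemma complK x : compl (compl x) = x.
Proof.
unfold qi_compl. pose proof (join_sym x zero) as H.
now rewrite zero_le, le_one, !one_imp in H.
Qed.

(** Since x ≤ y, [compl x] is [y ** ((y ** x) ** 0)], to be compared with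
    [y ** 0]. *)
Lemma compl_anti x y : x <== y -> compl y <== compl x.
Proof.
intros H. unfold qi_compl at 2. rewrite (imp_through_upper _ H), imp_imp_common_l.
apply compl_le_imp.
Qed.

Lemma le_imp_of_le x p : x <== p -> x <== p ** x.
Proof.
intros H. rewrite (imp_through_upper _ H), imp_absorb. apply le_refl.
Qed.

(** In an orthomodular lattice this says x ≤ x ∨ (x^⊥ ∧ y^⊥).  Writing x as
    [(x ** y) ** x] makes the two sides products with the same left factor, to
    which exchange applies. *)
Lemma le_imp_imp x y : x <== (x ** y) ** (y ** x).
Proof.
rewrite <- (contract x y) at 1.
rewrite exchange, imp_absorb, exchange, imp_absorb. apply le_refl.
Qed.

(** The symmetry axiom for comparable elements. *)
Lemma imp_imp_of_le x y : x <== y -> (y ** x) ** x = y.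
Proof.
intros H. pose proof (join_sym x y) as E.
now rewrite H, le_one, !one_imp in E.
Qed.

(** [_ ** x] is antitone on the elements above x, although not in general. *)
Lemma imp_anti_l x q p : x <== q -> q <== p -> p ** x <== q ** x.
Proof.
intros Hxq Hqp.
rewrite (imp_through_upper x Hqp), imp_imp_common_l.
apply imp_mono_r, le_imp_of_le.
apply le_trans with (p ** x).
- apply le_imp_of_le. exact (le_trans Hxq Hqp).
- apply imp_mono_r, Hxq.
Qed.

Lemma meetC x y : meet x y = meet y x.
Proof. unfold qi_meet. now rewrite exchange. Qed.

Lemma meet_le_l x y : meet x y <== x.
Proof.
rewrite <- (complK x) at 2. apply compl_anti. rewrite imp_imp_common_l.
apply compl_le_imp.
Qed.

Lemma meet_le_r x y : meet x y <== y.
Proof. rewrite meetC. apply meet_le_l. Qed.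

(** As z ≤ x, both [compl z] and [compl (meet x y)] are products with x on the
    left, and they are compared through [x ** z] ≤ [x ** y]. *)
Lemma meet_glb x y z : z <== x -> z <== y -> z <== meet x y.
Proof.
intros Hx Hy.
rewrite <- (complK z). apply compl_anti.
unfold qi_compl. rewrite (imp_through_upper zero Hx).
rewrite (imp_imp_common_l x y), (imp_imp_common_l x z).
apply imp_mono_r, compl_anti, imp_mono_r, Hy.
Qed.

Lemma joinC x y : join x y = join y x.
Proof. apply join_sym. Qed.

Lemma le_join_l x y : x <== join x y.
Proof. apply le_imp_of_le, le_imp_imp. Qed.

Lemma le_join_r x y : y <== join x y.
Proof. rewrite joinC. apply le_join_l. Qed.

(** Write z as [(z ** x) ** x]: by antitonicity it suffices that
    [z ** x] ≤ [(x ** y) ** (y ** x)].  For a = [z ** x] and b = [z ** y], the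
    right side is [(a ** b) ** (b ** a)], and [le_imp_imp] applies. *)
Lemma join_lub x y z : x <== z -> y <== z -> join x y <== z.
Proof.
intros Hx Hy.
rewrite <- (imp_imp_of_le Hx) at 1.
apply imp_anti_l.
- apply le_imp_of_le, Hx.
- rewrite (imp_through_upper y Hx), (imp_through_upper x Hy). apply le_imp_imp.
Qed.

Lemma lat_leE x y : lat_le meet x y <-> x <== y.
Proof.
unfold lat_le. split; intros H.
- rewrite <- H. apply meet_le_r.
- apply le_antisym; [apply meet_le_l | apply meet_glb; [apply le_refl | exact H]].
Qed.

Lemma bounded_lattice : is_bounded_lattice meet join zero one.
Proof.
pose proof meet_le_l as ml. pose proof meet_le_r as mr.
pose proof le_join_l as jl. pose proof le_join_r as jr.
split.
- apply meetC.
- apply joinC.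
- intros x y z. apply le_antisym; repeat apply meet_glb; eauto using le_trans.
- intros x y z. apply le_antisym; repeat apply join_lub; eauto using le_trans.
- intros x y. apply le_antisym; [apply ml | apply meet_glb; auto using le_refl].
- intros x y. apply le_antisym; [apply join_lub; auto using le_refl | apply jl].
- intros x. apply lat_leE, zero_le.
- intros x. apply lat_leE, le_one.
Qed.

Lemma ortholattice : is_ortholattice meet join compl zero one.
Proof.
split.
- exact bounded_lattice.
- intros x. unfold qi_meet, qi_compl.
  now rewrite imp_absorb, le_refl, one_imp.
- intros x. unfold qi_join, qi_compl.
  now rewrite imp_absorb, contract, contract, le_refl.
- intros x y. rewrite !lat_leE. apply compl_anti.
- intros x. now rewrite complK.
Qed.

(** * Orthomodularity *)

(** The algebraic form of x ∨ (x^⊥ ∧ y) = y.  As y^⊥ ≤ x^⊥, the product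
    y = [compl y ** y] can be rewritten with [compl x] on the left, and left
    products absorb. *)
Lemma compl_imp_upper x y : x <== y -> compl x ** y = y.
Proof.
intros H.
assert (E : y = compl x ** ((compl x ** compl y) ** y)).
{ rewrite <- (contract y zero) at 1. fold (compl y).
  now rewrite (imp_through_upper y (compl_anti H)), imp_imp_common_l. }
rewrite E at 1. rewrite imp_absorb. now symmetry.
Qed.

Lemma meet_compl_of_le x y : x <== y -> meet (compl x) y = compl (y ** x).
Proof.
intros H. unfold qi_meet. fold (compl (compl x)).
now rewrite (compl_imp_upper H), complK.
Qed.

Lemma orthomodular_lattice : is_orthomodular_lattice meet join compl zero one.
Proof.
split; [exact ortholattice |].
intros x y Hle. apply lat_leE in Hle.
rewrite (meet_compl_of_le Hle).
set (w := compl (y ** x)).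
apply le_antisym.
- (* An upper bound u of w satisfies w^⊥ · u = u, and y = w^⊥ · x. *)
  rewrite <- (compl_imp_upper (le_join_r x w)).
  rewrite <- (imp_imp_of_le Hle) at 1. rewrite <- (complK (y ** x)).
  apply imp_mono_r, le_join_l.
- apply join_lub; [exact Hle |].
  rewrite <- (complK y). apply compl_anti, compl_le_imp.
Qed.

(** * Quantifiers *)

(** The right side is [compl (meet (compl x) (compl y))] up to double
    complements. *)
Lemma join_de_morgan x y : join x y = (compl x ** compl y) ** x.
Proof.
assert (E : (compl x ** compl y) ** x = compl (meet (compl x) (compl y))).
{ unfold qi_meet. fold (compl (compl x)). rewrite (complK x).
  symmetry. apply complK. }
rewrite E. apply le_antisym.
- apply join_lub.
  + rewrite <- (complK x) at 1. apply compl_anti, meet_le_l.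
  + rewrite <- (complK y) at 1. apply compl_anti, meet_le_r.
- rewrite <- (complK (join x y)). apply compl_anti, meet_glb; apply compl_anti.
  + apply le_join_l.
  + apply le_join_r.
Qed.

Lemma monadic_quantifier dia :
  is_monadic_quasi_implication_algebra imp zero dia ->
  is_quantifier meet join compl zero dia.
Proof.
intros [_ Hidem Hext Hcompl Hzero Hjoin].
split.
- exact Hzero.
- intros x. apply lat_leE, Hext.
- intros x y. rewrite !join_de_morgan. apply Hjoin.
- intros x. apply le_antisym; [apply Hidem | apply Hext].
- exact Hcompl.
Qed.

End BoundedQuasiImplication.

Theorem theorem3p16 (I A : Type) (imp : A -> A -> A) (zero : A)
    (dia : I -> A -> A) (d : I -> I -> A)
    (hA : is_cylindric_quasi_implication_algebra imp zero dia d) :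
  is_quantum_cylindric_algebra
    (qi_meet imp zero) (qi_join imp) (qi_compl imp zero) zero (qi_one imp zero)
    dia d.
Proof.
destruct hA as [Hb Hm Hcomm Hsym Hrefl Hcomp].
split; try assumption.
- exact (orthomodular_lattice Hb).
- intros i. exact (monadic_quantifier Hb (Hm i)).
Qed.
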